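(* Let $(W,S)$ be a finite Coxeter system and $T=\bigcup_{w\in W}wSw^{-1}$. A subgroup $P\subseteq W$ is parabolic if and only if it is parabolic in the classical sense. In particular, if $S'\subseteq T$ is such that $(W,S')$ is a simple system (that is, a Coxeter system), then the parabolic subgroups in the classical sense defined by $S$ coincide with those defined by $S'$.
   Context: Let $n=|S|$. A simple system for $(W,T)$ is any subset $S'\subseteq T$ such that $(W,S')$ is a Coxeter system; all simple systems have cardinality $n$. A subgroup of $W$ is parabolic (for $(W,T)$) if it is of the form $\langle s_1,\dots,s_m\rangle$ for some simple system $\{s_1,\dots,s_n\}$ for $(W,T)$ and some $m\le n$. A subgroup is parabolic in the classical sense (with respect to $S$) if it is generated by a conjugate $wIw^{-1}$ ($w\in W$) of a subset $I\subseteq S$. *)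

(* Defs.v *)
From mathcomp Require Import all_boot all_fingroup.

Set Implicit Arguments.
Unset Strict Implicit.
Unset Printing Implicit Defensive.

Import GroupScope.

Section Coxeter.
Variables (gT : finGroupType) (W : {group gT}).

(* The last clause is the universal property of the group presentation
   < S | (s t)^m(s,t) = 1 >, with m(s,t) the order of s t in W. The target
   group is arbitrary, in particular possibly infinite. *)
Definition coxeter_system (S : {set gT}) : Prop :=
  [/\ <<S>> = W,
      {in S, forall s, #[s] = 2}
    & forall (H : groupType) (f : gT -> H),
        {in S &, forall s t, (f s * f t) ^+ #[s * t] = 1} ->
        exists phi : gT -> H,
          {in W &, {morph phi : x y / x * y}} /\ {in S, phi =1 f}].

Definition reflections (S : {set gT}) : {set gT} :=
  \bigcup_(w in W) S :^ w^-1.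

Definition simple_system (T S' : {set gT}) : Prop :=
  S' \subset T /\ coxeter_system S'.

Definition parabolic (T : {set gT}) (P : {group gT}) : Prop :=
  exists (s : seq gT) (m : nat),
    [/\ uniq s, simple_system T [set x in s], m <= size s
      & P = <<[set x in take m s]>> :> {set gT}].

Definition classical_parabolic (S : {set gT}) (P : {group gT}) : Prop :=
  exists (I : {set gT}) (w : gT),
    [/\ I \subset S, w \in W & P = <<I :^ w^-1>> :> {set gT}].

End Coxeter.

(* Main.v *)
Require Import Defs.
From mathcomp Require Import all_boot all_fingroup.

(* Idea. Bourbaki's action on signed reflections attaches to each Coxeter system
   an inversion cocycle N, with N (x y) = N x + x (N y) x^-1 (symmetric
   difference) and N s = {s}; it yields the exchange condition, longest elements
   and minimal coset representatives. A parabolic subgroup of rank k and one more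
   reflection always lie in a common parabolic subgroup of rank at most k + 1, so
   m reflections lie in one of rank at most m. Let S' be a simple system
   contained in the reflections of S. Both systems have the same reflections
   (Dyer), so if I is a subset of S' with m elements, then <I> lies in an
   S-parabolic Q of rank at most m, and Q lies in an S'-parabolic R of rank at
   most m. Nested S'-parabolics <I> and R with rank R <= rank <I> are equal, hence
   <I> = Q. *)

Set Implicit Arguments.
Unset Strict Implicit.
Unset Printing Implicit Defensive.

Import GroupScope.

Section Cocycle.
Variable gT : finGroupType.
Implicit Types (A S I J K X : {set gT}) (N : gT -> {set gT}) (r s t w x y : gT).

Lemma conjgg x : x ^ x = x.
Proof. by rewrite conjgE mulKg. Qed.

Lemma conj_eqgg x y : (x ^ y == y) = (x == y).
Proof. by rewrite -{2}(conjgg y) (inj_eq (conjg_inj y)). Qed.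

(* [N w] is the set of left inversions of [w], i.e. of the reflections that
   separate the chambers of 1 and [w]; its cardinal is the length of [w]. *)
Record inversion_cocycle S N : Prop := InversionCocycle {
  cocycle_inv : {in S, forall s, s^-1 = s};
  cocycleM : {in <<S>> &, forall x y r,
    (r \in N (x * y)) = (r \in N x) (+) (r ^ x \in N y)};
  cocycle_gen : {in S, forall s, N s = [set s]} }.

(** * Words, the exchange condition, reflections and longest elements *)

Section Basics.
Variables (S : {set gT}) (N : gT -> {set gT}).
Hypothesis cocN : inversion_cocycle S N.
Let W := <<S>>.
Let T := class_support S W.

Lemma cocycle_sub I : I \subset S -> inversion_cocycle I N.
Proof.
case: cocN => invS mulN genN sIS.
have sub := subsetP (genS sIS); have subI := subsetP sIS.
by split=> [s /subI|x y /sub Wx /sub Wy|s /subI]; [apply: invS|apply: mulN|apply: genN].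
Qed.

Lemma cocycle1 : N 1 = set0.
Proof.
apply/setP=> r; have := cocycleM cocN (group1 _) (group1 _) r.
by rewrite mulg1 conjg1 addbb inE.
Qed.

Lemma cocycleV r w : w \in W -> (r \in N w^-1) = (r ^ w^-1 \in N w).
Proof.
move=> Ww; have := cocycleM cocN (groupVr Ww) Ww r.
by rewrite mulVg cocycle1 inE; do 2!case: (_ \in N _).
Qed.

Lemma cocycle_consE r s w :
  s \in S -> w \in W -> (r \in N (s * w)) = (r == s) (+) (r ^ s \in N w).
Proof.
by move=> Ss Ww; rewrite (cocycleM cocN) ?(mem_gen Ss) // (cocycle_gen cocN) // inE.
Qed.

Lemma gen_mulK s w : s \in S -> s * (s * w) = w.
Proof. by move=> Ss; rewrite -{1}(cocycle_inv cocN Ss) mulKg. Qed.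

Lemma gen_word w : w \in W -> exists2 q : seq gT, {subset q <= S} & w = \prod_(x <- q) x.
Proof.
case/gen_prodgP => n [c Sc ->]; exists [seq c i | i <- index_enum 'I_n].
  by move=> x /mapP[i _ ->].
by rewrite big_map.
Qed.

Lemma word_gen (q : seq gT) : {subset q <= S} -> \prod_(x <- q) x \in W.
Proof. by move=> qS; rewrite big_seq group_prod // => x /qS Sx; rewrite mem_gen. Qed.

(** Walk along [q]: the first letter equal to the conjugate of [r] by the letters before it cancels
    against [r]. The word [q] need not be reduced. *)
Lemma exchange (q : seq gT) r : {subset q <= S} -> r \in N (\prod_(x <- q) x) ->
  exists q' : seq gT, [/\ {subset q' <= S}, size q' < size q
    & r * \prod_(x <- q) x = \prod_(x <- q') x].
Proof.
elim: q r => [|s q IHq] r; first by rewrite big_nil cocycle1 inE.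
move=> qS; have Ss : s \in S by rewrite qS ?mem_head.
have{}qS : {subset q <= S} by move=> x qx; rewrite qS ?inE ?qx ?orbT.
rewrite big_cons cocycle_consE ?word_gen //.
have [-> _|_ /= /IHq[//|q' [q'S lt_q' def]]] := eqVneq.
  by exists q; split=> //; rewrite gen_mulK.
exists (s :: q'); split=> //; first by move=> x; rewrite inE => /predU1P[->|/q'S].
by rewrite big_cons -def conjgE !mulgA mulgV mul1g.
Qed.

(** The first letter of a word is an inversion unless it is already one of the tail; in that case
    [exchange] yields a shorter word for [w]. *)
Lemma descentP w : w \in W -> w != 1 -> exists2 s, s \in S & s \in N w.
Proof.
case/gen_word=> q; have [n] := ubnP (size q).
elim: n q w => // n IHn [|s q] w lt_qn qS ->; first by rewrite big_nil eqxx.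
have Ss : s \in S by rewrite qS ?mem_head.
have{}qS : {subset q <= S} by move=> x qx; rewrite qS ?inE ?qx ?orbT.
rewrite big_cons => nz; have [sq|sq] := boolP (s \in N (\prod_(x <- q) x)).
  have [q' [q'S lt_q' def]] := exchange qS sq.
  apply: (IHn q') => //; rewrite -?def //.
  by rewrite (leq_trans lt_q') // ltnW.
by exists s; rewrite // cocycle_consE ?word_gen // conjgg eqxx (negPf sq).
Qed.

Lemma cocycle_eq0 w : w \in W -> N w = set0 -> w = 1.
Proof.
move=> Ww N0; apply/eqP/idPn=> /(descentP Ww)[s _].
by rewrite N0 inE.
Qed.

(** Conjugation by [s] carries [N w :\ s] onto [N (s * w)]. *)
Lemma card_descent s w : s \in S -> w \in W -> s \in N w -> #|N w| = #|N (s * w)|.+1.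
Proof.
move=> Ss Ww sNw; rewrite (cardsD1 s) sNw add1n -(cardJg (_ :\ _) s); congr _.+1.
apply: eq_card => r; rewrite cocycle_consE // mem_conjg (cocycle_inv cocN) //.
rewrite !inE (conj_eqgg r s).
by case: eqVneq => //= ->; rewrite conjgg sNw.
Qed.

Lemma reduced_word w : w \in W ->
  exists q : seq gT, [/\ {subset q <= S}, size q = #|N w| & w = \prod_(x <- q) x].
Proof.
have [n] := ubnP #|N w|; elim: n w => // n IHn w lt_wn Ww.
have [->|] := eqVneq w 1; first by exists [::]; rewrite cocycle1 cards0 big_nil; split.
case/(descentP Ww) => s Ss sNw; have := card_descent Ss Ww sNw.
have Wsw : s * w \in W by rewrite groupM // mem_gen.
move=> cardN; case: (IHn (s * w)) => // [|q [qS sz_q def]]; first by rewrite -cardN.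
exists (s :: q); split; first by move=> x; rewrite inE => /predU1P[->|/qS].
  by rewrite cardN /= sz_q.
by rewrite big_cons -def gen_mulK.
Qed.

Lemma card_cocycle_word (q : seq gT) :
  {subset q <= S} -> #|N (\prod_(x <- q) x)| <= size q.
Proof.
elim: q => [|s q IHq] qS; first by rewrite big_nil cocycle1 cards0.
have Ss : s \in S by rewrite qS ?mem_head.
have{}qS : {subset q <= S} by move=> x qx; rewrite qS ?inE ?qx ?orbT.
have Wq := word_gen qS; have := IHq qS; set w := \prod_(x <- q) x in Wq * => le_wq.
rewrite big_cons -/w /=; have [sNw|sNw] := boolP (s \in N w).
  have cardN := card_descent Ss Wq sNw.
  by rewrite -ltnS -cardN ltnW // ltnS (leq_trans le_wq).
have sNsw : s \in N (s * w) by rewrite cocycle_consE // conjgg eqxx (negPf sNw).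
have := card_descent Ss (groupM (mem_gen Ss) Wq) sNsw.
by rewrite gen_mulK // => ->.
Qed.

Lemma strong_exchange t w : w \in W -> t \in N w -> #|N (t * w)| < #|N w|.
Proof.
case/reduced_word=> q [qS <- ->] /(exchange qS)[q' [q'S lt_q' ->]].
exact: leq_ltn_trans (card_cocycle_word q'S) lt_q'.
Qed.

Lemma refl_gen t : t \in T -> t \in W.
Proof. by apply: subsetP; rewrite class_support_subG // subset_gen. Qed.

Lemma refl_conj t w : w \in W -> (t ^ w \in T) = (t \in T).
Proof.
have sub x y : y \in W -> x \in T -> x ^ y \in T.
  move=> Wy /imset2P[s z Ss Wz ->]; rewrite -conjgM.
  by apply: imset2_f; rewrite ?groupM.
by move=> Ww; apply/idP/idP=> [/(sub _ _ (groupVr Ww))|/(sub _ _ Ww)//]; rewrite conjgK.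
Qed.

Lemma gen_refl s : s \in S -> s \in T.
Proof. by move=> Ss; rewrite -(conjg1 s); apply: imset2_f. Qed.

Lemma reflV t : t \in T -> t^-1 = t.
Proof. by case/imset2P=> s x Ss _ ->; rewrite -conjVg (cocycle_inv cocN). Qed.

(** In [x^-1 * s * x] the contributions of [x^-1] and [x] at [t] are equal and cancel, which leaves
    that of [s]. *)
Lemma refl_cocycle t : t \in T -> t \in N t.
Proof.
case/imset2P=> s x Ss Wx ->; have Ws : s \in W by rewrite mem_gen.
rewrite {2}conjgE (cocycleM cocN) ?groupM ?groupV // (cocycleM cocN) ?groupM //.
rewrite cocycleV // !conjgK conjgg.
by rewrite (cocycle_gen cocN Ss) inE eqxx; case: (s \in N x).
Qed.

Lemma cocycle_refl w r : w \in W -> r \in N w -> r \in T.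
Proof.
case/gen_word=> q; elim: q w r => [|s q IHq] w r qS ->.
  by rewrite big_nil cocycle1 inE.
have Ss : s \in S by rewrite qS ?mem_head.
have{}qS : {subset q <= S} by move=> x qx; rewrite qS ?inE ?qx ?orbT.
rewrite big_cons cocycle_consE ?word_gen //.
have [-> _|_ /= /IHq-/(_ qS erefl)] := eqVneq.
  exact: gen_refl.
by rewrite refl_conj // mem_gen.
Qed.

Lemma gen_of_cocycle1 x : x \in W -> x != 1 -> {subset N x <= [set x]} -> x \in S.
Proof.
move=> Wx /(descentP Wx)[s Ss Ns] sub.
by move: (sub s Ns); rewrite inE => /eqP<-.
Qed.

Lemma refl_neq1 t : t \in T -> t != 1.
Proof. by move=> Tt; apply: contraTneq (refl_cocycle Tt) => ->; rewrite cocycle1 inE. Qed.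

(* [a] is the first wall in [X] crossed by a gallery from 1 to [y]. *)
Lemma wall_exists X y : {in X &, forall u v, v ^ u \in X} -> y \in W ->
    N y :&: X != set0 ->
  exists2 a, a \in N y :&: X & N a :&: X = [set a].
Proof.
have [n] := ubnP #|N y|; elim: n => // n IHn in X y * => lt_yn JX Wy NX.
have /(descentP Wy)[s Ss sNy]: y != 1.
  by apply: contraNneq NX => ->; rewrite cocycle1 set0I.
have Ws : s \in W by rewrite mem_gen.
have [sX|sX] := boolP (s \in X).
  exists s; rewrite ?inE ?sNy //; apply/setP=> r.
  by rewrite (cocycle_gen cocN Ss) !inE; case: eqVneq => //= ->.
have sV := cocycle_inv cocN Ss.
have Wsy : s * y \in W by rewrite groupM.
have Nsy r : r != s -> (r \in N (s * y)) = (r ^ s \in N y).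
  by move=> ns; rewrite cocycle_consE // (negPf ns).
have XJ r : (r \in X :^ s) = (r ^ s \in X) by rewrite mem_conjg sV.
have JK r : (r ^ s) ^ s = r by rewrite -conjgM -{1}sV mulVg conjg1.
(* As [s] is not in [X], drop it from [y] and conjugate [X] by it; the wall found there is
   conjugated back. *)
have /(IHn (X :^ s))[]//: #|N (s * y)| < n by rewrite -ltnS -(card_descent Ss).
- by move=> u v; rewrite !XJ conjJg => Xu Xv; apply: JX.
- case/set0Pn: NX => r /setIP[rNy Xr]; apply/set0Pn; exists (r ^ s).
  rewrite !inE Nsy ?JK ?rNy ?XJ ?JK //.
  by rewrite conj_eqgg; apply: contraNneq sX => <-.
move=> b /setIP[bNsy]; rewrite XJ => Xbs Nb.
have nbs : b != s by apply: contraNneq sX => bs; rewrite bs conjgg in Xbs.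
set a := b ^ s in Xbs *.
have Wb : b \in W.
  by rewrite refl_gen // (cocycle_refl (groupM Ws Wy)).
have aV : a^-1 = a by rewrite reflV // refl_conj // (cocycle_refl (groupM Ws Wy)).
exists a; first by rewrite inE Xbs -Nsy ?bNsy.
have aE : a = s * (b * s) by rewrite /a conjgE sV.
apply/setP=> r; rewrite in_set1 in_setI [in N a]aE cocycle_consE ?groupM //.
rewrite (cocycleM cocN) // (cocycle_gen cocN Ss) !in_set1.
have [Xr|Xr] := boolP (r \in X); last first.
  by rewrite andbF; apply/esym; apply: contraNF Xr => /eqP->.
have nrs : r != s by apply: contraNneq sX => <-.
have /setP/(_ (r ^ s)) := Nb; rewrite !inE XJ JK Xr !andbT (negPf nrs) /= => ->.
have -> : (r ^ s == b) = (r == a) by rewrite -[b]JK (inj_eq (conjg_inj s)).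
(* A further inversion of [a = s * b * s] in [X] could only come from the last [s]; closure of [X]
   under conjugation would then put [s = r ^ a] in [X]. *)
have [|_] := eqVneq ((r ^ s) ^ b) s; last by rewrite addbF.
move=> rsb; case/negP: sX.
have <- : r ^ a = s by rewrite aE !conjgM rsb conjgg.
exact: JX.
Qed.

(** Take [w0] with most inversions: a reflection [t] outside [N w0] is an inversion of [t * w0],
    which strong exchange then makes longer than [w0]. *)
Lemma longestP : exists2 w0, w0 \in W & N w0 = T.
Proof.
case: (arg_maxnP (fun w => #|N w|) (group1 <<S>>)) => w0 /= Ww0 maxw0.
exists w0 => //; apply/eqP; rewrite eqEsubset; apply/andP; split.
  by apply/subsetP=> r; apply: cocycle_refl.
apply/subsetP=> t Tt; apply/idPn=> tNw0; have Wt := refl_gen Tt.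
have Ntw0: t \in N (t * w0).
  by rewrite (cocycleM cocN) // conjgg refl_cocycle // (negPf tNw0).
have := strong_exchange (groupM Wt Ww0) Ntw0.
by rewrite -{1}(reflV Tt) mulKg ltnNge => /negP[]; apply/maxw0/groupM.
Qed.

(** [N (w * w0)] is the complement of [N w] in [T], so [w * w0] has no descent and is 1. *)
Lemma longest_eq w : w \in W -> S \subset N w -> N w = T.
Proof.
move=> Ww /subsetP SN; have [w0 Ww0 Nw0] := longestP.
have Nww0 r : (r \in N (w * w0)) = (r \in N w) (+) (r \in T).
  by rewrite (cocycleM cocN) // Nw0 refl_conj.
have ww0: w * w0 = 1.
  apply/eqP/idPn=> /(descentP (groupM Ww Ww0))[s Ss].
  by rewrite Nww0 SN // gen_refl.
apply/setP=> r; have := Nww0 r; rewrite ww0 cocycle1 inE.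
by case: (r \in N w); case: (r \in T).
Qed.

Lemma longest_invol w : w \in W -> N w = T -> w^-1 = w.
Proof.
move=> Ww Nw; apply/eqP; rewrite eq_invg_mul; apply/eqP/cocycle_eq0.
  exact: groupM.
by apply/setP=> r; rewrite (cocycleM cocN) // Nw refl_conj // addbb inE.
Qed.

(** In [N (w * s * w)] the two copies of [T] cancel and one reflection remains, so [s ^ w] is again
    a generator. *)
Lemma longest_conj w : w \in W -> N w = T -> S :^ w = S.
Proof.
move=> Ww Nw; apply/eqP; rewrite eqEcard cardJg leqnn andbT.
apply/subsetP=> _ /imsetP[s Ss ->]; have Ws: s \in W by rewrite mem_gen.
have Tsw: s ^ w \in T by rewrite refl_conj ?gen_refl.
apply: gen_of_cocycle1; rewrite ?refl_neq1 ?refl_gen // => r.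
rewrite {1}conjgE (longest_invol Ww Nw) (cocycleM cocN) ?groupM // cocycle_consE //.
rewrite Nw !refl_conj // addbCA addbb addbF inE => /eqP <-.
by rewrite -{1}(longest_invol Ww Nw) conjgKV.
Qed.


End Basics.

(** * Standard parabolic subgroups, their conjugates and ranks *)

Section Parabolic.
Variables (S : {set gT}) (N : gT -> {set gT}).
Hypothesis cocN : inversion_cocycle S N.
Let W := <<S>>.
Let T := class_support S W.

Lemma parabolic_refl J r : J \subset S ->
  r \in T -> (r \in class_support J <<J>>) = (r \in <<J>>).
Proof.
move=> sJS Tr; have cocJ := cocycle_sub cocN sJS.
apply/idP/idP=> [/refl_gen//|Jr].
by rewrite (cocycle_refl cocJ Jr) // (refl_cocycle cocN).
Qed.

Lemma parabolic_gen J s : J \subset S -> s \in S -> s \in <<J>> -> s \in J.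
Proof.
move=> sJS Ss Js; apply: (gen_of_cocycle1 (cocycle_sub cocN sJS)) => //.
  by rewrite (refl_neq1 cocN) // gen_refl.
by move=> r; rewrite (cocycle_gen cocN).
Qed.

(** The first wall [a] in [<<J>>] crossed on the way to [y] is its own only inversion in [<<J>>].
    All inversions of [a] lie there, so [a] is in [J]. *)
Lemma parabolic_min J y : J \subset S -> y \in W ->
  N y :&: J = set0 -> N y :&: <<J>> = set0.
Proof.
move=> sJS Wy NyJ; have cocJ := cocycle_sub cocN sJS.
apply/eqP/idPn=> /(wall_exists cocN)[||a /setIP[aNy Ja] Na] //.
  by move=> u v Ju Jv; rewrite groupJ.
have Ta := cocycle_refl cocN Wy aNy.
suff aJ : a \in J by move/setP/(_ a): NyJ; rewrite !inE aNy aJ.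
apply: (gen_of_cocycle1 cocJ) => //; first exact: (refl_neq1 cocN Ta).
move=> r rNa; rewrite -Na inE rNa.
by apply: refl_gen (cocycle_refl cocJ Ja rNa).
Qed.

(* Among the [x] such that [I :^ x] is again standard and such that neither [t]
   nor a reflection of [<<I>>] is an inversion of [x], take a longest one. With
   [J = I :^ x] and [K = s |: J], where [s] is an ascent of [x] outside [J],
   right multiplication by [w_J * w_K] inverts exactly the reflections of
   [<<K>> :^ x^-1] outside [<<I>>], so one of these is [t]. Such an [s] exists, since otherwise
   every reflection outside [<<I>>] is an inversion of [x]. *)
Lemma parabolic_extend I t : I \subset S -> t \in T ->
  exists x K, [/\ x \in W, K \subset S, #|K| <= #|I|.+1, I \subset <<K>> :^ x
    & t \in <<K>> :^ x].
Proof.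
move=> sIS Tt; have [It|It] := boolP (t \in <<I>>).
  by exists 1, I; rewrite group1 sIS leqnSn conjsg1 subset_gen.
pose P x := [&& x \in W, I :^ x \subset S, N x :&: <<I>> == set0 & t \notin N x].
have P1 : P 1 by rewrite /P group1 conjsg1 sIS (cocycle1 cocN) set0I eqxx inE.
case: (arg_maxnP (fun x => #|N x|) P1) => x /and4P[Wx sJS /eqP NxI tNx] maxx.
set J := I :^ x in sJS.
have genJ : <<J>> = <<I>> :^ x by rewrite genJ.
have genF s : s \in S -> s \notin J -> (s \in <<J>>) = false.
  by move=> Ss; apply: contraNF; apply: parabolic_gen.
have NVx r : (r \in N x^-1) = (r ^ x^-1 \in N x) by exact: (cocycleV cocN).
have NVJ r : r \in <<J>> -> r \notin N x^-1.
  rewrite genJ NVx mem_conjg => Ir; apply/negP=> Nr.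
  by move/setP/(_ (r ^ x^-1)): NxI; rewrite !inE Nr Ir.
have Tx r : (r ^ x \in T) = (r \in T) by apply: refl_conj.
have [|noK] := boolP [exists s in S :\: J, t ^ x \in <<s |: J>>].
  case/exists_inP=> s /setDP[Ss _] tK; exists x^-1, (s |: J).
  rewrite groupV Wx subUset sub1set Ss sJS cardsU1 !mem_conjgV tK; split=> //.
    by rewrite cardJg -add1n leq_add2r leq_b1.
  by rewrite -sub_conjg (subset_trans _ (subset_gen _)) // subsetUr.
have{}noK s : s \in S -> s \notin J -> t ^ x \notin <<s |: J>>.
  by move=> Ss Js; apply: contra noK => tK; apply/exists_inP; exists s; rewrite // inE Js.
have [|noasc] := boolP [exists s in S :\: J, s \notin N x^-1].
  case/exists_inP=> s /setDP[Ss Js] asc; set K := s |: J.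
  have sKS : K \subset S by rewrite subUset sub1set Ss.
  have sJK : <<J>> \subset <<K>> by rewrite genS // subsetUr.
  have [wJ JwJ NwJ] := longestP (cocycle_sub cocN sJS).
  have [wK KwK NwK] := longestP (cocycle_sub cocN sKS).
  have KwJ := subsetP sJK _ JwJ.
  have [WwJ WwK] : wJ \in W /\ wK \in W.
    by split; [move: JwJ|move: KwK]; apply/subsetP/genS.
  have Nw r : r \in T -> (r \in N (wJ * wK)) = (r \in <<J>>) (+) (r \in <<K>>).
    move=> Tr; rewrite (cocycleM cocN) // NwJ NwK.
    rewrite (parabolic_refl sJS Tr) (parabolic_refl sKS) ?refl_conj //.
    by rewrite memJ_norm // (subsetP (normG _)).
  have NVK : N x^-1 :&: <<K>> = set0.
    apply: parabolic_min; rewrite ?groupV //; apply/setP=> r; rewrite !inE.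
    have [->|_] := eqVneq r s; first by rewrite (negPf asc).
    by apply/negP=> /andP[Nr Jr]; have /negP[] := NVJ r (mem_gen Jr).
  have Nx' r : (r \in N (x * (wJ * wK))) = (r \in N x) (+) (r ^ x \in N (wJ * wK)).
    by rewrite (cocycleM cocN) ?groupM.
  have Px' : P (x * (wJ * wK)).
    apply/and4P; split; first by rewrite !groupM.
    - rewrite !conjsgM -/J (longest_conj (cocycle_sub cocN sJS)) //.
      rewrite (subset_trans _ sKS) // -(longest_conj (cocycle_sub cocN sKS) KwK) //.
      by rewrite conjSg subsetUr.
    - apply/eqP/setP=> r; rewrite [RHS]inE; apply/setIP=> -[Nr Ir].
      have Jr : r ^ x \in <<J>> by rewrite genJ memJ_conjg.
      have Tr : r \in T by apply: cocycle_refl Nr; rewrite ?groupM.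
      move: Nr; rewrite Nx' Nw ?Tx // Jr (subsetP sJK) // addbF => Nr.
      by move/setP/(_ r): NxI; rewrite !inE Nr Ir.
    - rewrite Nx' (negPf tNx) Nw ?Tx // (negPf (noK s Ss Js)).
      by rewrite genJ memJ_conjg (negPf It).
  have := maxx _ Px'; rewrite /geq /= leqNgt => /negP[].
  (* Inversions of [x] survive because their conjugates by [x] avoid [<<K>>]; [s ^ x^-1] is a new
     one. *)
  apply/proper_card/properP; split; last exists (s ^ x^-1).
  - apply/subsetP=> r Nr; rewrite Nx' Nr Nw ?Tx ?(cocycle_refl cocN Wx Nr) //.
    have NVr : r ^ x \in N x^-1 by rewrite NVx conjgK.
    have Kr : r ^ x \notin <<K>>.
      by apply/negP=> Kr; move/setP/(_ (r ^ x)): NVK; rewrite !inE NVr Kr.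
    by rewrite (negPf Kr) (negPf (contra (subsetP sJK _) Kr)).
  - rewrite Nx' -NVx (negPf asc) conjgKV Nw ?gen_refl //.
    rewrite genF //.
    by rewrite mem_gen // setU11.
  - by rewrite -NVx.
(* With no ascent left outside [J], every generator is an inversion of [x^-1 * wI], hence so is
   [t ^ x]; but [t] is neither in [N x] nor in [<<I>>]. *)
have [wI IwI NwI] := longestP (cocycle_sub cocN sIS).
have WwI : wI \in W by move: IwI; apply/subsetP/genS.
have Ny r : r \in T -> (r \in N (x^-1 * wI)) = (r \in N x^-1) (+) (r \in <<J>>).
  move=> Tr; rewrite (cocycleM cocN) ?groupV // NwI (parabolic_refl sIS).
    by rewrite genJ mem_conjg.
  by rewrite refl_conj ?groupV.
have : N (x^-1 * wI) = T.
  apply: (longest_eq cocN); rewrite ?groupM ?groupV //.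
  apply/subsetP=> s Ss; rewrite Ny ?gen_refl //.
  have [Js|Js] := boolP (s \in J).
    by rewrite (negPf (NVJ s _)) mem_gen.
  rewrite genF //.
  rewrite addbF; apply/idPn=> Ns; case/negP: noasc; apply/exists_inP; exists s => //.
  by rewrite inE Js.
move/setP/(_ (t ^ x)); rewrite Ny ?Tx // NVx conjgK (negPf tNx).
by rewrite genJ memJ_conjg (negPf It) Tt.
Qed.

Lemma parabolic_hull (A : {set gT}) : A \subset T ->
  exists x K, [/\ x \in W, K \subset S, #|K| <= #|A| & A \subset <<K>> :^ x].
Proof.
have [n] := ubnP #|A|; elim: n A => // n IHn A lt_An sAT.
have [->|[a Aa]] := set_0Vmem A.
  by exists 1, set0; rewrite group1 sub0set cards0 sub0set.
case: (IHn (A :\ a)).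
- by rewrite -ltnS (leq_trans _ lt_An) // ltnS [leqRHS](cardsD1 a) Aa.
- by rewrite (subset_trans (subsetDl _ _)).
move=> x [K [Wx sKS leK sAK]].
case: (@parabolic_extend K (a ^ x^-1)) => //.
  by rewrite refl_conj ?groupV // (subsetP sAT).
move=> y [L [Wy sLS leL sKL aL]]; exists (y * x), L; split=> //.
- exact: groupM.
- by rewrite [leqRHS](cardsD1 a) Aa (leq_trans leL).
rewrite -(setD1K Aa) subUset sub1set conjsgM mem_conjg aL.
by rewrite (subset_trans sAK) // conjSg gen_subG.
Qed.

(** Replace [y] by a shortest [u] giving the same conjugate of [<<K>>]; then [N u] misses [<<K>>].
    So for [s] in [I] the only inversion of [s ^ u^-1] is itself, which places it in [K], and
    cardinals force [I :^ u^-1 = K]. *)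
Lemma parabolic_sub_eq I K y : I \subset S -> K \subset S -> y \in W ->
  I \subset <<K>> :^ y -> #|K| <= #|I| -> <<I>> = <<K>> :^ y.
Proof.
move=> sIS sKS Wy sIK leKI.
pose P u := (u \in W) && (<<K>> :^ u == <<K>> :^ y).
have Py : P y by rewrite /P Wy eqxx.
case: (arg_minnP (fun u => #|N u|) Py) => u /andP[Wu /eqP Ku] minu.
have WK := subsetP (genS sKS).
have NuK r : r \in <<K>> -> r \notin N u.
  move=> Kr; apply/negP=> Nr; have := strong_exchange cocN Wu Nr.
  rewrite ltnNge => /negP[]; apply: minu.
  by rewrite /P groupM ?(WK r) // conjsgM (conjGid Kr) Ku eqxx.
rewrite -Ku in sIK *; suff <-: I :^ u^-1 = K by rewrite genJ conjsgKV.
apply/eqP; rewrite eqEcard cardJg leKI andbT.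
apply/subsetP=> _ /imsetP[s Is ->].
have Ss : s \in S by apply: subsetP Is.
have Kr : s ^ u^-1 \in <<K>> by rewrite -mem_conjg (subsetP sIK).
apply: (gen_of_cocycle1 (cocycle_sub cocN sKS)) => //.
  by rewrite (refl_neq1 cocN) // refl_conj ?groupV // gen_refl.
move=> q Nq; have Kq := refl_gen (cocycle_refl (cocycle_sub cocN sKS) Kr Nq).
have Ws : s \in W by rewrite mem_gen.
move: Nq; rewrite {1}conjgE invgK (cocycleM cocN) ?groupM ?groupV //.
rewrite (cocycle_consE cocN) ?groupV // (negPf (NuK q Kq)) /= (cocycleV cocN) //.
have -> : ((q ^ u) ^ s) ^ u^-1 = q ^ (s ^ u^-1).
  by rewrite -!conjgM [s ^ _]conjgE invgK mulgA.
rewrite (negPf (NuK _ (groupJ Kq Kr))) addbF.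
by move=> /eqP <-; rewrite inE conjgK.
Qed.

End Parabolic.

(** * Comparison of two systems with common reflections *)

Section Reflections.
Variables (S : {set gT}) (N : gT -> {set gT}).
Hypothesis cocN : inversion_cocycle S N.
Let W := <<S>>.
Let T := class_support S W.

(* Dyer: intersecting with the conjugates of [A] turns [N] into a cocycle for
   the walls [A0] of the chamber of 1; a reflection conjugate to no element of
   [A] would have no inversions there, hence be 1. *)
Lemma class_support_refl_gen A : A \subset T -> <<A>> = W -> class_support A W = T.
Proof.
move=> sAT genA; set X := class_support A W.
have XJ r x : x \in W -> (r ^ x \in X) = (r \in X).
  by rewrite /X -genA; apply: refl_conj.
have sXT : {subset X <= T}.
  by move=> _ /imset2P[a x Aa Wx ->]; rewrite refl_conj // (subsetP sAT).
have TW t : t \in T -> t \in W by apply: refl_gen.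
have JX : {in X &, forall u v, v ^ u \in X} by move=> u v /sXT/TW Wu; rewrite XJ.
pose A0 := [set a in X | N a :&: X == [set a]].
have sA0W : {subset <<A0>> <= W}.
  apply/subsetP; rewrite gen_subG; apply/subsetP=> a.
  by rewrite inE => /andP[/sXT/TW Wa _].
have cocA0 : inversion_cocycle A0 (fun w => N w :&: X).
  split=> [a|x y /sA0W Wx /sA0W Wy r|a]; try by rewrite inE => /andP[Xa /eqP].
    by rewrite inE => /andP[/sXT Ta _]; apply: (reflV cocN).
  rewrite !inE (cocycleM cocN) // XJ //.
  by case: (r \in X); rewrite ?andbT ?andbF.
(* Let [a] in [A0] be the first wall crossed towards [w]. If [t] is not [a], pass to [t ^ a] and
   [a * w], which has fewer inversions in [X]. *)
have walk t w : w \in W -> t \in X -> t \in N w -> t \in <<A0>>.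
  have [n] := ubnP #|N w :&: X|; elim: n t w => // n IHn t w lt_wn Ww Xt Nt.
  have /(wall_exists cocN JX Ww)[a /setIP[Na Xa] NXa] : N w :&: X != set0.
    by apply/set0Pn; exists t; rewrite inE Nt.
  have A0a : a \in <<A0>> by rewrite mem_gen // inE Xa NXa eqxx.
  have [-> // | nta] := eqVneq t a.
  have Wa := sA0W a A0a.
  have Naw r : r \in X -> (r \in N (a * w)) = (r == a) (+) (r ^ a \in N w).
    move=> Xr; rewrite (cocycleM cocN) //; congr (_ (+) _).
    by have /setP/(_ r) := NXa; rewrite !inE Xr andbT.
  have aK r : (r ^ a) ^ a = r by rewrite -{2}(reflV cocN (sXT a Xa)) conjgK.
  rewrite -(conjgK a t) (reflV cocN (sXT a Xa)) groupJ //.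
  apply: (IHn _ (a * w)); rewrite ?groupM ?XJ //; last first.
    by rewrite Naw ?XJ // aK Nt conj_eqgg (negPf nta).
  rewrite -ltnS (leq_trans _ lt_wn) // ltnS.
  rewrite (cardsD1 a (N w :&: X)) inE Na Xa add1n ltnS -(cardJg _ a) subset_leq_card //.
  apply/subsetP=> r; rewrite mem_conjg (reflV cocN (sXT a Xa)) inE XJ // => /andP[Nr Xr].
  move: Nr; rewrite Naw ?XJ // aK conj_eqgg !inE Xr andbT.
  by have [->|] := eqVneq r a; rewrite ?Na.
have genA0 : <<A0>> = W.
  apply/eqP; rewrite eqEsubset; apply/andP; split; first exact/subsetP.
  rewrite -genA gen_subG; apply/subsetP=> a Aa.
  have Xa : a \in X by rewrite /X -genA gen_refl.
  by apply: (walk a a); rewrite ?(refl_cocycle cocN) ?sXT ?TW ?sXT.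
apply/eqP; rewrite eqEsubset; apply/andP; split; first exact/subsetP.
apply/subsetP=> _ /imset2P[s x Ss Wx ->]; rewrite XJ //.
have Ts : s \in T by apply: gen_refl.
apply: contraLR (refl_neq1 cocN Ts) => Xs; rewrite negbK; apply/eqP.
apply: (cocycle_eq0 cocA0); first by rewrite genA0 TW.
apply/setP=> r; rewrite (cocycle_gen cocN) // !inE.
by case: eqVneq => //= ->; apply: negPf.
Qed.

(* Squeeze [<<I>>] in an [S]-parabolic and this in an [S']-parabolic, without
   increasing the rank: as [<<I>>] is an [S']-parabolic, all three coincide. *)
Lemma parabolic_transfer S' N' I : inversion_cocycle S' N' -> <<S'>> = W ->
  S' \subset T -> I \subset S' ->
  exists x K, [/\ x \in W, K \subset S & <<I>> = <<K>> :^ x].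
Proof.
move=> cocN' genS' sS'T sIS'.
have [x [K [Wx sKS leKI sIK]]] := parabolic_hull cocN (subset_trans sIS' sS'T).
have T'T := class_support_refl_gen sS'T genS'.
have : K :^ x \subset class_support S' <<S'>>.
  rewrite genS' T'T; apply/subsetP=> _ /imsetP[s Ks ->].
  by rewrite refl_conj // gen_refl // (subsetP sKS).
case/(parabolic_hull cocN')=> y [L [Wy sLS' leL sKL]].
have sIL : I \subset <<L>> :^ y.
  by rewrite (subset_trans sIK) // -genJ gen_subG.
have eqIL := parabolic_sub_eq cocN' sIS' sLS' Wy sIL.
exists x, K; split=> //; apply/eqP; rewrite eqEsubset gen_subG sIK /=.
by rewrite -genJ eqIL ?gen_subG // (leq_trans leL) ?cardJg.
Qed.

End Reflections.
End Cocycle.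

(** * From the presentation to the cocycle, and the two notions of parabolic *)

Section CoxeterCocycle.
Variables (gT : finGroupType) (W : {group gT}).
Implicit Types (S I : {set gT}) (P : {group gT}).

(* Bourbaki's action of a reflection on signed reflections. *)
Definition signed_conj (x : gT) (p : gT * bool) := (p.1 ^ x, p.2 (+) (p.1 == x)).

Lemma signed_conj_inj x : injective (signed_conj x).
Proof. by move=> [r e] [r' e'] [/conjg_inj<- /addIb<-]. Qed.

Definition signed_conj_perm x : {perm gT * bool} := perm (@signed_conj_inj x).

(** Counting from 0, the [j]-th letter of the alternating word [s t s t ...] flips the sign exactly
    when [r = (s * t) ^+ j * s]. *)
Lemma signed_conj_perm_expE s t k r e : s^-1 = s -> t^-1 = t ->
  ((signed_conj_perm s * signed_conj_perm t) ^+ k) (r, e) =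
  (r ^ ((s * t) ^+ k), e (+) \big[addb/false]_(0 <= j < k.*2) (r == (s * t) ^+ j * s)).
Proof.
move=> sV tV; set c := s * t; elim: k => [|k IHk].
  by rewrite !expg0 perm1 conjg1 big_nil addbF.
rewrite expgSr permM IHk permM !permE /signed_conj /= doubleS !big_nat_recr //= !addbA.
have conj_eq x y z : (x ^ y == z :> gT) = (x == z ^ y^-1).
  exact: can2_eq (conjgK y) (conjgKV y) x z.
have sc : s * (c ^+ k)^-1 = c ^+ k * s.
  have cs : c ^ s = c^-1 by rewrite /c conjgE -mulgA mulKg invMg sV tV.
  by rewrite -expVgn -cs -conjXg conjgE mulKVg.
congr (_, _ (+) _ (+) _); first by rewrite -!conjgM -expgSr.
  by rewrite conj_eq conjgE invgK sc mulgA -expgD addnn.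
rewrite -conjgM conj_eq conjgE invgK invMg sV sc.
by rewrite !mulgA -(mulgA (c ^+ k) s t) -/c -expgSr -expgD addSn addnn.
Qed.

Lemma coxeter_cocycle S : coxeter_system W S -> exists N, inversion_cocycle S N.
Proof.
case=> genW ord2 univ.
have sV : {in S, forall s, s^-1 = s}.
  by move=> s /ord2 o2; apply/eqP; rewrite eq_invg_mul -expg2 -o2 expg_order.
case: (univ {perm gT * bool} signed_conj_perm) => [s t Ss St|phi [phiM phiS]].
  apply/permP=> -[r e]; rewrite perm1 signed_conj_perm_expE ?sV // expg_order conjg1.
  (* Since [(s * t) ^+ m = 1], the two halves of the range contribute the same flips and cancel: the
     Coxeter relation holds. *)
  congr (_, _); set m := #[s * t]; rewrite -addnn (@big_cat_nat _ _ _ m) ?leq_addr //=.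
  rewrite -[X in bigop _ (index_iota X (_ + _)) _]add0n big_addn addnK.
  under [X in _ (+) (_ (+) X)]eq_bigr do rewrite expgD expg_order mulg1.
  by rewrite addbb addbF.
pose N w := [set r | (phi w (r, false)).2].
have phi1 : phi 1 = 1.
  by have := phiM _ _ (group1 W) (group1 W); rewrite mulg1 -{1}[phi 1]mulg1 => /mulgI.
(* The sign enters additively, so composing permutations gives the cocycle identity. *)
have phiE w : w \in W -> forall r e, phi w (r, e) = (r ^ w, e (+) (r \in N w)).
  rewrite -genW; case/(gen_prodgP) => n [c Sc ->].
  elim: n c Sc => [|n IHn] c Sc r e.
    by rewrite inE big_ord0 phi1 !perm1 conjg1 addbF.
  have Wc : \prod_(i < n) c (lift ord0 i) \in W.
    by rewrite group_prod // => i _; rewrite -genW mem_gen.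
  have Wc0 : c ord0 \in W by rewrite -genW mem_gen.
  rewrite inE big_ord_recl phiM // !permM (phiS _ (Sc _)) !permE /signed_conj /=.
  by rewrite !IHn //= conjgM addbA.
exists N; split=> //; rewrite ?genW.
  move=> x y Wx Wy r; rewrite inE phiM // permM !phiE //=.
move=> s Ss; apply/setP=> r; rewrite !inE phiS // permE //.
Qed.

Lemma reflectionsE S : reflections W S = class_support S W.
Proof.
rewrite class_supportEr /reflections (reindex_inj invg_inj) /=.
by apply: eq_big => [w|w _]; rewrite ?groupV ?invgK.
Qed.

Lemma coxeter_systemJ S w : w \in W -> coxeter_system W S -> coxeter_system W (S :^ w).
Proof.
move=> Ww [genW ord2 univ]; split=> [|_ /imsetP[s Ss ->]|H f frel].
- by rewrite genJ genW conjGid.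
- by rewrite orderJ ord2.
case: (univ H (fun x => f (x ^ w))) => [s t Ss St|phi [phiM phiS]].
  by rewrite -(orderJ _ w) conjMg frel ?memJ_conjg.
exists (fun x => phi (x ^ w^-1)); split=> [x y Wx Wy|_ /imsetP[s Ss ->]] /=.
  by rewrite conjMg phiM ?groupJ ?groupV.
by rewrite conjgK phiS.
Qed.

Lemma classical_parabolic_transfer S S' P :
    coxeter_system W S -> coxeter_system W S' -> S' \subset class_support S W ->
  classical_parabolic W S' P -> classical_parabolic W S P.
Proof.
move=> coxS coxS' sS'T [I [w [sIS' Ww defP]]].
have [[N cocN] [N' cocN']] := (coxeter_cocycle coxS, coxeter_cocycle coxS').
have [[genW _ _] [genW' _ _]] := (coxS, coxS').
rewrite -genW in sS'T; have genS' : <<S'>> = <<S>> by rewrite genW genW'.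
have [x [K [Wx sKS eqIK]]] := parabolic_transfer cocN cocN' genS' sS'T sIS'.
rewrite genW in Wx; exists K, (w * x^-1); rewrite sKS groupM ?groupV //; split=> //.
by rewrite defP invMg invgK !genJ conjsgM eqIK.
Qed.

Lemma simple_systemJ S w : w \in W -> coxeter_system W S ->
  simple_system W (reflections W S) (S :^ w).
Proof.
move=> Ww coxS; split; last exact: coxeter_systemJ.
by rewrite reflectionsE class_supportEr (bigcup_max w).
Qed.

Lemma parabolic_subset S' I T P : simple_system W T S' -> I \subset S' ->
  P = <<I>> :> {set gT} -> parabolic W T P.
Proof.
(* Listing [I] first makes it an initial segment of [S']. *)
move=> simS' sIS' defP; exists (enum I ++ enum (S' :\: I)), #|I|.
rewrite cat_uniq !enum_uniq andbT size_cat -cardE leq_addr take_size_cat ?cardE //.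
split=> //.
- by apply/hasPn=> x; rewrite !mem_enum inE => /andP[].
- suff -> : [set x in enum I ++ enum (S' :\: I)] = S' by [].
  by apply/setP=> x; rewrite inE mem_cat !mem_enum -in_setU -{1}(setIidPr sIS') setID.
- by rewrite defP; congr <<_>>; apply/setP=> x; rewrite inE mem_enum.
Qed.

End CoxeterCocycle.

Theorem corollary4p4 (gT : finGroupType) (W : {group gT}) (S : {set gT}) :
  coxeter_system W S ->
  (forall P : {group gT}, P \subset W ->
     (parabolic W (reflections W S) P <-> classical_parabolic W S P)) /\
  (forall S' : {set gT}, simple_system W (reflections W S) S' ->
     forall P : {group gT}, P \subset W ->
     (classical_parabolic W S P <-> classical_parabolic W S' P)).
Proof.
move=> coxS; have genW : <<S>> = W by case: coxS.
split=> [P _|S' [sS'T coxS'] P _]; split.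
- case=> s [m [_ [sS'T coxS'] _ defP]]; rewrite reflectionsE in sS'T.
  apply: (classical_parabolic_transfer coxS coxS' sS'T).
  exists [set x in take m s], 1; rewrite invg1 conjsg1; split=> //.
  by apply/subsetP=> x; rewrite !inE => /mem_take.
- case=> I [w [sIS Ww defP]].
  (* The conjugate [S :^ w^-1] is itself a simple system and contains [I :^ w^-1]. *)
  apply: (parabolic_subset (simple_systemJ (groupVr Ww) coxS) _ defP).
  by rewrite conjSg.
(* By Dyer's result [S] consists of reflections of [S'], so the two systems can exchange roles. *)
- rewrite reflectionsE in sS'T; apply: classical_parabolic_transfer => //.
  have [N cocN] := coxeter_cocycle coxS; have [genW' _ _] := coxS'.
  have := class_support_refl_gen cocN; rewrite genW => -> //.
  by rewrite -genW; apply/subsetP=> s; apply: gen_refl.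
by apply: classical_parabolic_transfer; rewrite -?reflectionsE.
Qed.
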